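(* Let $X,Y,Z,W$ be real-valued random variables and $U$ a (latent) random variable, all on a common probability space, with $Y$ integrable. Assume: (A1) (Confounding bridge) (i) there exists a function $h_0$ with $E\{h_0(W)^2\}<\infty$ such that $E(Y\mid U,Z=z)=E\{h_0(W)\mid U,Z=z\}$ for all $z$; (ii) there exists a function $g_0$ with $E\{g_0(Z)^2\}<\infty$ such that $E(Y\mid U,W=w)=E\{g_0(Z)\mid U,W=w\}$ for all $w$. (A2) (Completeness) (i) for any square-integrable function $l$ (i.e. $E\{l(W)^2\}<\infty$), $E\{l(W)\mid Z\}=0$ almost surely if and only if $l(W)=0$ almost surely; (ii) for any square-integrable function $l$ (i.e. $E\{l(Z)^2\}<\infty$), $E\{l(Z)\mid W\}=0$ almost surely if and only if $l(Z)=0$ almost surely. Then there exist unique (up to almost sure equality of $h(W)$ and of $g(Z)$) square-integrable functions $h$ and $g$ satisfying, almost surely, $$E(Y\mid Z)=E\{h(W)\mid Z\},\qquad E(Y\mid W)=E\{g(Z)\mid W\}.$$ Moreover, these functions are equal to the functions $h_0$ and $g_0$ of (A1), i.e. $h(W)=h_0(W)$ and $g(Z)=g_0(Z)$ almost surely; hence $h_0,g_0$ are identifiable, i.e. uniquely determined by the joint distribution of the observed variables. If in addition $X,Y,Z,W$ are mutually conditionally independent given $U$, then almost surely $$E(Y\mid X)=E\{h_0(W)\mid X\}=E\{g_0(Z)\mid X\}.$$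
   Context: The functions $h_0,g_0$ in (A1) are called confounding bridge functions. The identities in (A1) are understood as almost sure identities of conditional expectations given $(U,Z)$ and given $(U,W)$, respectively. *)

(* Defs.v *)
From HB Require Import structures.
From mathcomp Require Import all_boot all_order all_algebra.
From mathcomp Require Import all_classical all_reals all_analysis.
Set Implicit Arguments.
Unset Strict Implicit.
Unset Printing Implicit Defensive.
Import Order.TTheory GRing.Theory Num.Theory.
Import numFieldNormedType.Exports.
Local Open Scope classical_set_scope.
Local Open Scope ring_scope.

(* [e] is a version of E(Y | V), the conditional expectation of the real
   variable [Y] given the sigma-algebra sigma(V) of preimages under [V] of the
   measurable sets. *)
Definition is_condexp d d' (T : measurableType d) (T' : measurableType d')
    (R : realType) (P : probability T R) (V : T -> T') (Y e : T -> R) : Prop :=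
  let sigmaV := preimage_set_system [set: T] V measurable in
  [/\ forall B : set R, measurable B -> sigmaV (e @^-1` B),
      P.-integrable [set: T] (EFin \o e)
    & forall A : set T, sigmaV A ->
        (\int[P]_(x in A) (e x)%:E = \int[P]_(x in A) (Y x)%:E)%E].

(* A chosen version of E(Y | V).  For measurable [V] and integrable [Y] versions
   exist by Radon-Nikodym and are almost surely equal, so that almost sure
   statements do not depend on the choice; the default value 0 is only taken
   when there is no version, e.g. when [Y] is not integrable. *)
Definition condexp d d' (T : measurableType d) (T' : measurableType d')
    (R : realType) (P : probability T R) (V : T -> T') (Y : T -> R) : T -> R :=
  xget (fun=> 0) [set e | is_condexp P V Y e].

Notation "''CE_' P [ Y | V ]" := (condexp P V Y)
  (at level 5, P at level 4, Y, V at level 99, format "''CE_' P [ Y  |  V ]").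

Definition as_eq d (T : measurableType d) (R : realType)
    (P : probability T R) (f g : T -> R) : Prop :=
  \forall x \ae P, f x = g x.

Definition square_integrable_at d (T : measurableType d) (R : realType)
    (P : probability T R) (V : {RV P >-> R}) (h : R -> R) : Prop :=
  measurable_fun [set: R] h /\ ('E_P[(fun x => h (V x) ^+ 2)%R] < +oo)%E.

(* Conditioning on (U, Z = z) for all z is conditioning on sigma(U, Z). *)
Definition confounding_bridge d dU (T : measurableType d)
    (TU : measurableType dU) (R : realType) (P : probability T R)
    (U : {RV P >-> TU}) (Y Z W : {RV P >-> R}) (h0 g0 : R -> R) : Prop :=
  [/\ square_integrable_at W h0,
      as_eq P 'CE_P[Y | fun x => (U x, Z x)]
              'CE_P[h0 \o W | fun x => (U x, Z x)],
      square_integrable_at Z g0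
    & as_eq P 'CE_P[Y | fun x => (U x, W x)]
              'CE_P[g0 \o Z | fun x => (U x, W x)]].

Definition completeness d (T : measurableType d) (R : realType)
    (P : probability T R) (Z W : {RV P >-> R}) : Prop :=
  (forall l : R -> R, square_integrable_at W l ->
     as_eq P 'CE_P[l \o W | Z] (fun=> 0) <-> as_eq P (l \o W) (fun=> 0)) /\
  (forall l : R -> R, square_integrable_at Z l ->
     as_eq P 'CE_P[l \o Z | W] (fun=> 0) <-> as_eq P (l \o Z) (fun=> 0)).

(* Taking some of the sets to be the whole line gives the product rule for every
   subfamily. *)
Definition cond_mutually_independent d dU (T : measurableType d)
    (TU : measurableType dU) (R : realType) (P : probability T R)
    (U : {RV P >-> TU}) (X Y Z W : {RV P >-> R}) : Prop :=
  forall A B C D : set R,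
    measurable A -> measurable B -> measurable C -> measurable D ->
    as_eq P
      'CE_P[\1_(X @^-1` A `&` Y @^-1` B `&` Z @^-1` C `&` W @^-1` D) | U]
      (fun x => 'CE_P[\1_(X @^-1` A) | U] x * 'CE_P[\1_(Y @^-1` B) | U] x *
                'CE_P[\1_(Z @^-1` C) | U] x * 'CE_P[\1_(W @^-1` D) | U] x).

Definition same_joint_law d d' (T : measurableType d) (T' : measurableType d')
    (R : realType) (P : probability T R) (P' : probability T' R)
    (X Y Z W : {RV P >-> R}) (X' Y' Z' W' : {RV P' >-> R}) : Prop :=
  forall A : set (R * R * R * R), measurable A ->
    P ((fun x => (X x, Y x, Z x, W x)) @^-1` A) =
    P' ((fun x => (X' x, Y' x, Z' x, W' x)) @^-1` A).

(* Main.v *)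
(* Conditioning the bridge identity given (U, Z) down to Z shows that h0 solves
   E(Y | Z) = E(h(W) | Z); completeness, applied to the difference of two
   solutions, makes the solution unique.  The equation and the square
   integrability of h only involve the law of (Y, Z, W), whence identifiability.
   Conditional independence given U yields, and likewise for Z and W,
   E(1_A(X) f(Y)) = E(P(X in A | U) f(Y)); since P(X in A | U) is a function of U,
   the right-hand side only depends on E(f(Y) | U), and
   E(Y | U) = E(h0(W) | U) = E(g0(Z) | U) by conditioning the bridge identities
   down to U. *)
From HB Require Import structures.
Require Import Defs.
From mathcomp Require Import all_boot all_order all_algebra.
From mathcomp Require Import all_classical all_reals all_analysis.
From mathcomp Require Import measurable_realfun lra.
Set Implicit Arguments.
Unset Strict Implicit.
Unset Printing Implicit Defensive.
Import Order.TTheory GRing.Theory Num.Theory.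
Import numFieldNormedType.Exports.
Local Open Scope classical_set_scope.
Local Open Scope ring_scope.

(** * Versions of conditional expectations: existence, uniqueness, comparison *)

Lemma as_eq_comp (R : realType) (d d' : measure_display) (T : measurableType d)
    (T' : measurableType d') (P : probability T R) (V : {mfun T >-> T'})
    (phi1 phi2 : T' -> R) :
  measurable_fun [set: T'] phi1 -> measurable_fun [set: T'] phi2 ->
  P.-integrable [set: T] (EFin \o (phi1 \o V)) ->
  P.-integrable [set: T] (EFin \o (phi2 \o V)) ->
  (forall B : set T', measurable B ->
    (\int[P]_(x in V @^-1` B) (phi1 (V x))%:E =
     \int[P]_(x in V @^-1` B) (phi2 (V x))%:E)%E) ->
  as_eq P (phi1 \o V) (phi2 \o V).
Proof.
move=> /measurable_EFinP mphi1 /measurable_EFinP mphi2 i1 i2 phi12.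
(* Under the law of [V] every measurable set is a test set, so equal integrals force almost
   everywhere equality; the exceptional set is then pulled back along [V]. *)
have : ae_eq (distribution P V) [set: T'] (EFin \o phi1) (EFin \o phi2).
  apply: integral_ae_eq => //; first exact: integrable_pushforward.
  move=> B _ mB; have mVB := measurable_funPTI V mB.
  rewrite !integral_pushforward//=; first exact: phi12.
  - exact: integrableS i2.
  - exact: integrableS i1.
move=> [N [mN N0 subN]]; exists (V @^-1` N); split => //.
  exact: measurable_funPTI.
by move=> x /= ne; apply: subN => /= /(_ I) [].
Qed.

Section condexp.
Context (R : realType) (d d' : measure_display) (T : measurableType d)
  (T' : measurableType d') (P : probability T R).
Implicit Types (V : {mfun T >-> T'}) (Y e : T -> R).

(** Reduces the search for a version to a density on the codomain of [V]: measurability for sigma(V)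
    is automatic for a function of [V]. *)
Lemma is_condexp_comp V Y (phi : T' -> R) :
  (distribution P V).-integrable [set: T'] (EFin \o phi) ->
  (forall B : set T', measurable B ->
    (\int[distribution P V]_(y in B) (phi y)%:E =
     \int[P]_(x in V @^-1` B) (Y x)%:E)%E) ->
  is_condexp P V Y (phi \o V).
Proof.
move=> iphi phiY; have mphi := measurable_int _ iphi.
have iphiV : P.-integrable [set: T] (EFin \o (phi \o V)).
  apply/integrableP; split; first exact: (measurableT_comp mphi (measurable_funPT V)).
  have /integrableP[_] := iphi.
  by rewrite ge0_integral_distribution//; exact: measurableT_comp mphi.
split => //.
- move=> B mB; exists (phi @^-1` B); last by rewrite setTI.
  by rewrite -[_ @^-1` _]setTI; move/measurable_EFinP : mphi; exact.
- move=> _ [B mB <-]; rewrite setTI -phiY//.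
  rewrite integral_pushforward//; apply: integrableS iphiV => //.
  exact: measurable_funPTI.
Qed.

Lemma is_condexp_integral V Y e (B : set T') : is_condexp P V Y e ->
  measurable B ->
  (\int[P]_(x in V @^-1` B) (e x)%:E = \int[P]_(x in V @^-1` B) (Y x)%:E)%E.
Proof. by move=> [_ _ eY] mB; apply: eY; exists B => //; rewrite setTI. Qed.

Lemma is_condexp_unique V Y1 Y2 e1 e2 :
  is_condexp P V Y1 e1 -> is_condexp P V Y2 e2 ->
  (forall B : set T', measurable B ->
    (\int[P]_(x in V @^-1` B) (Y1 x)%:E =
     \int[P]_(x in V @^-1` B) (Y2 x)%:E)%E) ->
  as_eq P e1 e2.
Proof.
move=> ce1 ce2 Y12; case: (ce1) (ce2) => [me1 ie1 _] [me2 ie2 _].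
(* With [T] equipped with sigma(V), [e1] and [e2] are measurable functions of the identity map, so
   [as_eq_comp] applies without factoring them through [V]. *)
pose G := g_sigma_algebra_preimageType V.
have mid : measurable_fun [set: T] (idfun : T -> G).
  by move=> _ _ [B mB <-]; rewrite !setTI; exact: measurable_funPTI.
pose id_G : {mfun T >-> G} :=
  HB.pack (idfun : T -> G) (isMeasurableFun.Build _ _ _ _ _ mid).
apply: (@as_eq_comp _ _ _ _ _ P id_G e1 e2) => //.
- by move=> _ B mB; rewrite setTI; exact: me1.
- by move=> _ B mB; rewrite setTI; exact: me2.
- move=> _ [B mB <-] /=; rewrite setTI.
  by rewrite (is_condexp_integral ce1)// (is_condexp_integral ce2)// Y12.
Qed.

(** The function [phi] is the Radon-Nikodym derivative, with respect to the law of [V], of the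
    pushforward by [V] of the charge with density [Y]. It is finite everywhere, so [fine] loses
    nothing. *)
Lemma condexp_existence V Y : P.-integrable [set: T] (EFin \o Y) ->
  exists2 phi : T' -> R, measurable_fun [set: T'] phi &
    is_condexp P V Y (phi \o V).
Proof.
move=> iY.
(* The measurability of V is an argument of the charge structure. *)
pose nuV : {charge set T' -> \bar R} := pushforward (induced_charge iY) V.
pose nu := nuV (measurable_funPT V).
have nuP : nu `<< distribution P V.
  apply/null_content_dominatesP => A mA PA0.
  rewrite /nu /= /pushforward /induced_charge; apply: null_set_integral => //.
  - exact: measurable_funPTI.
  - by apply: measurable_funTS; exact: measurable_int iY.
pose phi := fine \o Radon_Nikodym nu (distribution P V).
have phiE : EFin \o phi = Radon_Nikodym nu (distribution P V).
  by apply/funext => y /=; rewrite fineK// Radon_Nikodym_fin_num.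
exists phi.
  apply/measurable_EFinP; rewrite phiE.
  exact: measurable_int (Radon_Nikodym_integrable nuP).
apply: is_condexp_comp => [|B mB].
  by rewrite phiE; exact: Radon_Nikodym_integrable.
rewrite -[LHS]/(\int[_]_(y in B) (EFin \o phi) y)%E phiE.
by rewrite -Radon_Nikodym_integral.
Qed.

Lemma condexp_indic_existence V (A : set T) : measurable A ->
  exists phi : T' -> R, [/\ measurable_fun [set: T'] phi,
    forall y, 0 <= phi y & is_condexp P V \1_A (phi \o V)].
Proof.
move=> mA; have Aoo : (P A < +oo)%E by rewrite ltey_eq fin_num_measure.
pose muV : {measure set T' -> \bar R} := pushforward (mfrestr mA Aoo) V.
pose mu := muV (measurable_funPT V).
have fin_mu : fin_num_fun mu.
  by move=> B mB; apply: fin_num_measure; exact: measurable_funPTI.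
pose nu : {finite_measure set T' -> \bar R} :=
  HB.pack (Measure.sort mu) (Measure_isFinite.Build _ _ _ mu fin_mu).
have nuP : nu `<< distribution P V.
  apply/null_content_dominatesP => B mB PB0; apply/eqP; rewrite -measure_le0.
  have mVB := measurable_funPTI V mB.
  rewrite -[leRHS]PB0; apply: le_measure; last exact: subIsetl.
  - by rewrite inE; exact: measurableI.
  - by rewrite inE.
have [f [f0 ffin intf fE]] := radon_nikodym_sigma_finite nuP.
have phiE : EFin \o (fine \o f) = f by apply/funext => y /=; rewrite fineK.
exists (fine \o f); split.
- by apply/measurable_EFinP; rewrite phiE; exact: measurable_int intf.
- by move=> y /=; rewrite fine_ge0.
- apply: is_condexp_comp => [|B mB]; first by rewrite phiE.
  rewrite -[LHS]/(\int[_]_(y in B) (EFin \o (fine \o f)) y)%E phiE -fE//.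
  rewrite integral_indic//; last exact: measurable_funPTI.
  by rewrite setIC.
Qed.

Lemma is_condexp_condexp V Y : P.-integrable [set: T] (EFin \o Y) ->
  is_condexp P V Y 'CE_P[Y | V].
Proof.
by move=> /(condexp_existence V)[phi _ ce]; exact: (xgetPex (fun=> 0) (ex_intro _ _ ce)).
Qed.

(** Trades chosen versions for integrals over sets of sigma(V). The later transfers between
    sigma-algebras and between probability spaces are carried out on the integral side. *)
Lemma as_eq_condexpP V Y1 Y2 :
  P.-integrable [set: T] (EFin \o Y1) -> P.-integrable [set: T] (EFin \o Y2) ->
  as_eq P 'CE_P[Y1 | V] 'CE_P[Y2 | V] <->
  (forall B : set T', measurable B ->
    (\int[P]_(x in V @^-1` B) (Y1 x)%:E =
     \int[P]_(x in V @^-1` B) (Y2 x)%:E)%E).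
Proof.
move=> /(is_condexp_condexp V) ce1 /(is_condexp_condexp V) ce2.
split=> [e12 B mB|]; last exact: is_condexp_unique.
rewrite -(is_condexp_integral ce1)// -(is_condexp_integral ce2)//.
have mVB := measurable_funPTI V mB.
apply: ae_eq_integral => //.
- by apply: measurable_funTS; case: ce1 => _ /(measurable_int P).
- by apply: measurable_funTS; case: ce2 => _ /(measurable_int P).
- by apply: filterS e12 => x -> _.
Qed.

End condexp.

(** * Pulling a function of [V] out of an integral *)

Section pull_out.
Context (R : realType) (d d' : measure_display) (T : measurableType d)
  (T' : measurableType d') (P : probability T R) (V : {mfun T >-> T'}).
Import HBNNSimple.

(** Simple functions increase to [phi], and monotone convergence applies. The resulting limit sees
    [F] only through its integrals over preimages under [V], so [F] may be replaced by any function
    with the same such integrals. *)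
Lemma ge0_integral_comp_mulE (phi : T' -> R) (F : T -> R)
    (mphi : measurable_fun [set: T'] (EFin \o phi)) :
  (forall y, 0 <= phi y) -> measurable_fun [set: T] F -> (forall x, 0 <= F x) ->
  let h := nnsfun_approx measurableT mphi in
  (\int[P]_x (phi (V x) * F x)%:E =
   limn (fun n => \sum_(y \in range (h n))
     y%:E * \int[P]_(x in V @^-1` (h n @^-1` [set y])) (F x)%:E))%E.
Proof.
move=> phi0 mF F0 h.
have mh n : measurable_fun [set: T] (fun x => h n (V x)).
  exact: (measurableT_comp (measurable_funPT (h n)) (measurable_funPT V)).
have mind n y : measurable_fun [set: T] (fun x => \1_(h n @^-1` [set y]) (V x) : R).
  apply: (measurableT_comp (f := \1_(h n @^-1` [set y]) : T' -> R)).
    by apply: measurable_indic; exact: measurable_funPTI.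
  exact: measurable_funPT.
transitivity (\int[P]_x limn (fun n => (h n (V x) * F x)%:E))%E.
  apply: eq_integral => x _; apply/esym/cvg_lim => //.
  under eq_fun do rewrite EFinM.
  rewrite EFinM; apply: cvgeZr => //.
  by apply: cvg_nnsfun_approx => // y _; rewrite lee_fin.
rewrite monotone_convergence//.
- apply: congr_lim; apply/funext => n.
  transitivity (\int[P]_x (\sum_(y \in range (h n))
      (y * (\1_(h n @^-1` [set y]) (V x) * F x))%:E))%E.
    apply: eq_integral => x _; rewrite {1}fimfunE fsumEFin//.
    congr EFin; rewrite mulr_fsuml; apply: eq_fsbigr => y _.
    by rewrite mulrA.
  rewrite ge0_integral_fsum//.
  + apply: eq_fsbigr => y; rewrite inE => -[z _ <-].
    under eq_integral do rewrite EFinM.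
    rewrite ge0_integralZl//; last 2 first.
    - by move=> x _; rewrite lee_fin mulr_ge0.
    - by rewrite lee_fin.
    - congr (_ * _)%E; rewrite [RHS]integral_mkcond.
      apply: eq_integral => x _; rewrite patchE indicE.
      rewrite -[x \in _]/(V x \in h n @^-1` [set h n z]).
      by case: ifPn => _; rewrite ?mul1r ?mul0r.
    - by apply/measurable_EFinP/measurable_funM => //; exact: mind.
  + move=> y; apply/measurable_EFinP/measurable_funM => //.
    by apply: measurable_funM => //; exact: mind.
  (* For negative [y] the fibre of [h n] is empty and the term is 0. *)
  + by move=> y x _; rewrite lee_fin mulrA mulr_ge0// -lee_fin EFinM nnfun_muleindic_ge0.
- by move=> n; apply/measurable_EFinP/measurable_funM.
- by move=> n x _; rewrite lee_fin mulr_ge0.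
- move=> x _ m n mn; rewrite lee_fin ler_wpM2r//.
  exact/lefP/nd_nnsfun_approx.
Qed.

Lemma ge0_eq_integral_mul_comp (phi : T' -> R) (F G : T -> R) :
  measurable_fun [set: T'] phi -> (forall y, 0 <= phi y) ->
  measurable_fun [set: T] F -> (forall x, 0 <= F x) ->
  measurable_fun [set: T] G -> (forall x, 0 <= G x) ->
  (forall B : set T', measurable B ->
    (\int[P]_(x in V @^-1` B) (F x)%:E = \int[P]_(x in V @^-1` B) (G x)%:E)%E) ->
  (\int[P]_x (phi (V x) * F x)%:E = \int[P]_x (phi (V x) * G x)%:E)%E.
Proof.
move=> /measurable_EFinP mphi phi0 mF F0 mG G0 FG.
rewrite !(ge0_integral_comp_mulE mphi)//; apply: congr_lim; apply/funext => n.
apply: eq_fsbigr => y _; rewrite FG//.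
Qed.

End pull_out.

(** * Positive and negative parts, and conditional independence given [U] *)

Lemma eq_integral_funrposneg (R : realType) (d : measure_display)
    (T : measurableType d) (mu : {measure set T -> \bar R}) (D : set T)
    (F G : T -> R) : measurable D ->
  mu.-integrable D (EFin \o F) -> mu.-integrable D (EFin \o G) ->
  (\int[mu]_(x in D) (F x)%:E = \int[mu]_(x in D) (G x)%:E <->
   \int[mu]_(x in D) (F^\+ x + G^\- x)%:E =
   \int[mu]_(x in D) (G^\+ x + F^\- x)%:E)%E.
Proof.
move=> mD iF iG.
have iFp := integrable_funrpos mD iF; have iFn := integrable_funrneg mD iF.
have iGp := integrable_funrpos mD iG; have iGn := integrable_funrneg mD iG.
have posneg H : mu.-integrable D (EFin \o H^\+) -> mu.-integrable D (EFin \o H^\-) ->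
    (\int[mu]_(x in D) (H x)%:E =
     \int[mu]_(x in D) (H^\+ x)%:E - \int[mu]_(x in D) (H^\- x)%:E)%E.
  move=> iHp iHn; rewrite -integralB_EFin//; apply: eq_integral => x _.
  by rewrite -EFinB -[in LHS](funrposBneg H).
rewrite (posneg F)// (posneg G)//.
under [in X in _ <-> X = _]eq_integral do rewrite EFinD.
under [in X in _ <-> _ = X]eq_integral do rewrite EFinD.
rewrite !integralD_EFin//.
move: (integrable_fin_num mD iFp) (integrable_fin_num mD iFn).
move: (integrable_fin_num mD iGp) (integrable_fin_num mD iGn).
rewrite /comp.
(* By integrability the four integrals are finite, so terms may be moved across the equation; the
   case of four reals is linear arithmetic. *)
move: (integral _ _ _) => a; move: (integral _ _ _) => b.
move: (integral _ _ _) => c; move: (integral _ _ _) => e.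
case: a b c e => [a| |] [b| |] [c| |] [e| |]// _ _ _ _.
rewrite -!EFinB -!EFinD; split=> -[] E; congr EFin; lra.
Qed.

Definition cond_indep_pair d dU d1 d2 (T : measurableType d)
    (TU : measurableType dU) (T1 : measurableType d1) (T2 : measurableType d2)
    (R : realType) (P : probability T R) (U : T -> TU) (V1 : T -> T1)
    (V2 : T -> T2) : Prop :=
  forall (A : set T1) (B : set T2), measurable A -> measurable B ->
    as_eq P 'CE_P[\1_(V1 @^-1` A `&` V2 @^-1` B) | U]
      (fun x => 'CE_P[\1_(V1 @^-1` A) | U] x * 'CE_P[\1_(V2 @^-1` B) | U] x).

Section conditional_independence.
Context (R : realType) (d dU dX : measure_display) (T : measurableType d)
  (TU : measurableType dU) (TX : measurableType dX)
  (P : probability T R) (U : {mfun T >-> TU}) (X : {mfun T >-> TX}).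

(* Replacing 1_A(X) by its conditional expectation phi(U) is first done against
   the indicators of sigma(Y), where it is the factorization of the conditional
   probability, and then against f(Y). *)
Lemma cond_indep_ge0_integral (dY : measure_display) (TY : measurableType dY)
    (Y : {mfun T >-> TY}) (A : set TX) (phi : TU -> R) (f : TY -> R) :
  cond_indep_pair P U X Y -> measurable A ->
  measurable_fun [set: TU] phi -> (forall u, 0 <= phi u) ->
  is_condexp P U \1_(X @^-1` A) (phi \o U) ->
  measurable_fun [set: TY] f -> (forall y, 0 <= f y) ->
  (\int[P]_(x in X @^-1` A) (f (Y x))%:E = \int[P]_x (phi (U x) * f (Y x))%:E)%E.
Proof.
move=> XY mA mphi phi0 cphi mf f0.
have mXA := measurable_funPTI X mA.
have mphiU : measurable_fun [set: T] (phi \o U).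
  exact: (measurableT_comp mphi (measurable_funPT U)).
have indE (D : set T) (g : T -> R) : measurable D ->
    (\int[P]_(x in D) (g x)%:E = \int[P]_x (g x * \1_D x)%:E)%E.
  move=> mD; rewrite integral_mkcond; apply: eq_integral => x _.
  by rewrite patchE indicE; case: ifPn => _; rewrite ?mulr1 ?mulr0.
(* With psi(U) a version of P(Y in C | U), both sides equal E(phi(U) psi(U)): the left one by the
   factorization given [U], the right one by pulling out phi(U). *)
have key (C : set TY) : measurable C ->
    (\int[P]_(x in Y @^-1` C) (\1_(X @^-1` A) x)%:E =
     \int[P]_(x in Y @^-1` C) (phi (U x))%:E)%E.
  move=> mC; have mYC := measurable_funPTI Y mC.
  have [psi [mpsi psi0 cpsi]] := condexp_indic_existence P U mYC.
  have mpsiU : measurable_fun [set: T] (psi \o U).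
    exact: (measurableT_comp mpsi (measurable_funPT U)).
  have iI (D : set T) : measurable D -> P.-integrable [set: T] (EFin \o \1_D).
    by move=> mD; exact: integrable_indic.
  have cXY := is_condexp_condexp U (iI _ (measurableI _ _ mXA mYC)).
  transitivity (\int[P]_x ('CE_P[\1_(X @^-1` A `&` Y @^-1` C) | U] x)%:E)%E.
    have := is_condexp_integral cXY measurableT.
    rewrite preimage_setT => ->.
    rewrite !integral_indic//; last exact: measurableI.
    by rewrite setIT.
  transitivity (\int[P]_x (phi (U x) * psi (U x))%:E)%E.
    apply: ae_eq_integral => //.
    - by case: cXY => _ /(measurable_int P).
    - by apply/measurable_EFinP/measurable_funM.
    - have := is_condexp_unique (is_condexp_condexp U (iI _ mXA)) cphi (fun _ _ => erefl).
      have := is_condexp_unique (is_condexp_condexp U (iI _ mYC)) cpsi (fun _ _ => erefl).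
      by apply: filterS3 (XY _ _ mA mC) => x -> -> ->.
  rewrite [RHS]indE//.
  apply: ge0_eq_integral_mul_comp => // B mB.
  exact: is_condexp_integral cpsi mB.
rewrite indE//.
transitivity (\int[P]_x (f (Y x) * phi (U x))%:E)%E; last first.
  by apply: eq_integral => x _; rewrite mulrC.
(* Now f(Y) is the factor pulled out, and [key] compares the integrals over sigma(Y). *)
exact: ge0_eq_integral_mul_comp.
Qed.

(** Once negative parts have changed sides, an integrand mixes [Y] and [W]; additivity handles each
    summand by its own pairwise independence from [X]. *)
Lemma cond_indep_ge0_integralD (dY dW : measure_display)
    (TY : measurableType dY) (TW : measurableType dW)
    (Y : {mfun T >-> TY}) (W : {mfun T >-> TW})
    (A : set TX) (phi : TU -> R) (f : TY -> R) (g : TW -> R) :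
  cond_indep_pair P U X Y -> cond_indep_pair P U X W -> measurable A ->
  measurable_fun [set: TU] phi -> (forall u, 0 <= phi u) ->
  is_condexp P U \1_(X @^-1` A) (phi \o U) ->
  measurable_fun [set: TY] f -> (forall y, 0 <= f y) ->
  measurable_fun [set: TW] g -> (forall w, 0 <= g w) ->
  (\int[P]_(x in X @^-1` A) (f (Y x) + g (W x))%:E =
   \int[P]_x (phi (U x) * (f (Y x) + g (W x)))%:E)%E.
Proof.
move=> XY XW mA mphi phi0 cphi mf f0 mg g0.
have mphiU : measurable_fun [set: T] (phi \o U).
  exact: (measurableT_comp mphi (measurable_funPT U)).
have mfY : measurable_fun [set: T] (f \o Y).
  exact: (measurableT_comp mf (measurable_funPT Y)).
have mgW : measurable_fun [set: T] (g \o W).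
  exact: (measurableT_comp mg (measurable_funPT W)).
have mXA := measurable_funPTI X mA.
under eq_integral do rewrite EFinD.
under [in RHS]eq_integral do rewrite mulrDr EFinD.
rewrite !ge0_integralD//.
- by rewrite (cond_indep_ge0_integral XY mA mphi)// (cond_indep_ge0_integral XW mA mphi).
- by move=> x _; rewrite lee_fin mulr_ge0.
- by apply/measurable_EFinP/measurable_funM.
- by move=> x _; rewrite lee_fin mulr_ge0.
- by apply/measurable_EFinP/measurable_funM.
- by move=> x _; rewrite lee_fin.
- by apply: measurable_funTS; apply/measurable_EFinP.
- by move=> x _; rewrite lee_fin.
- by apply: measurable_funTS; apply/measurable_EFinP.
Qed.

(* Moving negative parts to the other side keeps every integrand nonnegative, so
   that nothing has to be bounded or integrable when multiplied by phi(U). *)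
Lemma cond_indep_condexp (dY dW : measure_display)
    (TY : measurableType dY) (TW : measurableType dW)
    (Y : {mfun T >-> TY}) (W : {mfun T >-> TW}) (f : TY -> R) (g : TW -> R) :
  cond_indep_pair P U X Y -> cond_indep_pair P U X W ->
  measurable_fun [set: TY] f -> P.-integrable [set: T] (EFin \o (f \o Y)) ->
  measurable_fun [set: TW] g -> P.-integrable [set: T] (EFin \o (g \o W)) ->
  as_eq P 'CE_P[f \o Y | U] 'CE_P[g \o W | U] ->
  as_eq P 'CE_P[f \o Y | X] 'CE_P[g \o W | X].
Proof.
move=> XY XW mf iY mg iW /(as_eq_condexpP U iY iW) fg.
apply/(as_eq_condexpP X iY iW) => A mA.
have mXA := measurable_funPTI X mA.
have [phi [mphi phi0 cphi]] := condexp_indic_existence P U mXA.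
have iS (F : T -> R) (B : set T) : measurable B ->
    P.-integrable [set: T] (EFin \o F) -> P.-integrable B (EFin \o F).
  by move=> mB; exact: integrableS.
have [mfp mfn] := (measurable_funrpos mf, measurable_funrneg mf).
have [mgp mgn] := (measurable_funrpos mg, measurable_funrneg mg).
have [_] := eq_integral_funrposneg mXA (iS _ _ mXA iY) (iS _ _ mXA iW).
apply.
(* Taking the positive or negative part commutes with composition by computation, which exposes
   functions of [Y] and of [W]. *)
rewrite -[LHS]/(\int[P]_(x in X @^-1` A) (f^\+ (Y x) + g^\- (W x))%:E)%E.
rewrite -[RHS]/(\int[P]_(x in X @^-1` A) (g^\+ (W x) + f^\- (Y x))%:E)%E.
rewrite (cond_indep_ge0_integralD XY XW mA mphi phi0 cphi)//.
rewrite (cond_indep_ge0_integralD XW XY mA mphi phi0 cphi)//.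
have mc d' (T' : measurableType d') (V : {mfun T >-> T'}) (h : T' -> R) :
    measurable_fun [set: T'] h -> measurable_fun [set: T] (fun x => h (V x)).
  by move=> mh; exact: (measurableT_comp mh (measurable_funPT V)).
(* Both sides carry the factor phi(U), so it suffices to compare integrals over sigma(U); this is
   [fg] with negative parts moved. *)
apply: (@ge0_eq_integral_mul_comp _ _ _ _ _ P U phi
  (fun x => f^\+ (Y x) + g^\- (W x)) (fun x => g^\+ (W x) + f^\- (Y x))) => //.
- by apply: measurable_funD; exact: mc.
- by move=> x; rewrite addr_ge0.
- by apply: measurable_funD; exact: mc.
- by move=> x; rewrite addr_ge0.
- move=> B mB; have mUB := measurable_funPTI U mB.
  have [+ _] := eq_integral_funrposneg mUB (iS _ _ mUB iY) (iS _ _ mUB iW).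
  by apply; exact: fg.
Qed.

End conditional_independence.

(** * Square-integrable functions of a random variable *)

Section square_integrable.
Context (R : realType) (d : measure_display) (T : measurableType d)
  (P : probability T R) (V : {RV P >-> R}).
Implicit Types h : R -> R.

Lemma square_integrable_atP h : square_integrable_at V h <->
  measurable_fun [set: R] h /\
  P.-integrable [set: T] (EFin \o (fun x => h (V x) ^+ 2)).
Proof.
rewrite /square_integrable_at unlock; split=> -[mh h2]; split=> //.
- apply/integrableP; split.
    apply/measurable_EFinP; apply: measurable_funX.
    exact: (measurableT_comp mh (measurable_funPT V)).
  by under eq_integral do rewrite /= ger0_norm ?sqr_ge0//.
- have /integrableP[_] := h2.
  by under eq_integral do rewrite /= ger0_norm ?sqr_ge0//.
Qed.

(** Domination by |a| <= 1 + a^2, the constant 1 being integrable for a probability. *)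
Lemma square_integrable_at_integrable h : square_integrable_at V h ->
  P.-integrable [set: T] (EFin \o (h \o V)).
Proof.
move=> /square_integrable_atP[mh ih2].
have i1 : P.-integrable [set: T] (EFin \o cst (1 : R)).
  by apply: finite_measure_integrable_cst.
apply: (le_integrable _ _ _ (integrableD measurableT i1 ih2)) => //.
  apply/measurable_EFinP; exact: (measurableT_comp mh (measurable_funPT V)).
move=> x _ /=; rewrite lee_fin [leRHS]ger0_norm ?addr_ge0 ?sqr_ge0//.
rewrite ler_norml; set a := h (V x).
by apply/andP; split; nra.
Qed.

(** Domination by (a - b)^2 <= 2 a^2 + 2 b^2, where the gap is (a + b)^2. *)
Lemma square_integrable_atB h1 h2 :
  square_integrable_at V h1 -> square_integrable_at V h2 ->
  square_integrable_at V (h1 \- h2).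
Proof.
move=> /square_integrable_atP[mh1 i1] /square_integrable_atP[mh2 i2].
have mB : measurable_fun [set: R] (h1 \- h2) by exact: measurable_funB.
apply/square_integrable_atP; split => //.
have i12 := integrableD measurableT (integrableZl measurableT 2 i1)
  (integrableZl measurableT 2 i2).
apply: (le_integrable _ _ _ i12) => //.
  apply/measurable_EFinP; apply: measurable_funX.
  exact: (measurableT_comp mB (measurable_funPT V)).
move=> x _ /=; rewrite lee_fin.
rewrite [leLHS]ger0_norm ?sqr_ge0// [leRHS]ger0_norm; last first.
  by rewrite addr_ge0// mulr_ge0// sqr_ge0.
have := sqr_ge0 (h1 (V x) + h2 (V x)).
set a := h1 _; set b := h2 _; rewrite !expr2; nra.
Qed.

End square_integrable.

(** * Conditioning down, and uniqueness from completeness *)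

Lemma is_condexp_cst (R : realType) (d d' : measure_display)
    (T : measurableType d) (T' : measurableType d') (P : probability T R)
    (V : {mfun T >-> T'}) (r : R) : is_condexp P V (cst r) (cst r).
Proof.
apply: (@is_condexp_comp _ _ _ _ _ P V (cst r) (cst r)).
  exact: finite_measure_integrable_cst.
move=> B mB; rewrite -[LHS]/(\int[distribution P V]_(y in B) cst r%:E y)%E.
rewrite -[RHS]/(\int[P]_(x in V @^-1` B) cst r%:E x)%E !integral_cst//.
exact: measurable_funPTI.
Qed.

(** Since [V1] factors through [V], sigma(V1) lies in sigma(V) and there are fewer sets on which to
    compare integrals. [V] is a bare function so that the pairs (U, Z) and (U, W) of the bridge
    assumption fit directly. *)
Lemma condexp_tower (R : realType) (d d1 d2 : measure_display)
    (T : measurableType d) (T1 : measurableType d1) (T2 : measurableType d2)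
    (P : probability T R) (V : T -> T2) (q : T2 -> T1) (V1 : {mfun T >-> T1})
    (Y1 Y2 : T -> R) :
  measurable_fun [set: T] V -> measurable_fun [set: T2] q -> V1 =1 q \o V ->
  P.-integrable [set: T] (EFin \o Y1) -> P.-integrable [set: T] (EFin \o Y2) ->
  as_eq P 'CE_P[Y1 | V] 'CE_P[Y2 | V] ->
  as_eq P 'CE_P[Y1 | V1] 'CE_P[Y2 | V1].
Proof.
move=> mV mq V1E i1 i2.
pose V' : {mfun T >-> T2} := HB.pack V (isMeasurableFun.Build _ _ _ _ V mV).
move=> /(as_eq_condexpP V' i1 i2) H; apply/(as_eq_condexpP V1 i1 i2) => B mB.
have -> : V1 @^-1` B = V' @^-1` (q @^-1` B).
  by apply/seteqP; split=> x /=; rewrite V1E.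
by apply: H; rewrite -[_ @^-1` _]setTI; exact: mq.
Qed.

Lemma complete_condexp_unique (R : realType) (d : measure_display)
    (T : measurableType d) (P : probability T R) (V W : {RV P >-> R})
    (Y : T -> R) (h1 h2 : R -> R) :
  (forall l : R -> R, square_integrable_at W l ->
     as_eq P 'CE_P[l \o W | V] (fun=> 0) <-> as_eq P (l \o W) (fun=> 0)) ->
  square_integrable_at W h1 -> square_integrable_at W h2 ->
  as_eq P 'CE_P[Y | V] 'CE_P[h1 \o W | V] ->
  as_eq P 'CE_P[Y | V] 'CE_P[h2 \o W | V] ->
  as_eq P (h1 \o W) (h2 \o W).
Proof.
move=> complete sq1 sq2 e1 e2.
have i1 := square_integrable_at_integrable sq1.
have i2 := square_integrable_at_integrable sq2.
have sqB := square_integrable_atB sq1 sq2.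
have iB := square_integrable_at_integrable sqB.
have e12 : as_eq P 'CE_P[h1 \o W | V] 'CE_P[h2 \o W | V].
  by apply: filterS2 e1 e2 => x -> ->.
have /(complete _ sqB) : as_eq P 'CE_P[(h1 \- h2) \o W | V] (fun=> 0).
  (* Linearity is used on integrals, not on the chosen versions: the version for the difference is
     compared with the constant 0. *)
  apply: (is_condexp_unique (is_condexp_condexp V iB) (is_condexp_cst P V 0)).
  move=> B mB; have mVB := measurable_funPTI V mB.
  transitivity (\int[P]_(x in V @^-1` B) ((h1 (W x))%:E - (h2 (W x))%:E))%E.
    by apply: eq_integral => x _; rewrite -EFinB.
  rewrite integralB_EFin//.
  - move/(as_eq_condexpP V i1 i2) : e12 => /(_ _ mB) /= ->.
    rewrite subee ?integral0//.
    by apply: integrable_fin_num => //; exact: integrableS i2.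
  - exact: integrableS i1.
  - exact: integrableS i2.
by apply: filterS => x /eqP; rewrite subr_eq0 => /eqP.
Qed.

(** * Transfer between probability spaces with equal laws *)

Section equal_laws.
Context (R : realType) (d d' dS : measure_display) (T : measurableType d)
  (T' : measurableType d') (S : measurableType dS) (P : probability T R)
  (P' : probability T' R) (J : {mfun T >-> S}) (J' : {mfun T' >-> S}).
Hypothesis lawJ : forall A : set S, measurable A -> P (J @^-1` A) = P' (J' @^-1` A).

Lemma eq_law_ge0_integral (F : S -> \bar R) :
  measurable_fun [set: S] F -> (forall s, 0 <= F s)%E ->
  (\int[P]_x F (J x) = \int[P']_x F (J' x))%E.
Proof.
move=> mF F0; rewrite -[LHS](@ge0_integral_distribution _ _ _ _ _ P J F)//.
rewrite -[RHS](@ge0_integral_distribution _ _ _ _ _ P' J' F)//.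
apply: eq_measure_integral => A mA _; exact: lawJ.
Qed.

Lemma eq_law_integral (F : S -> \bar R) (D : set S) :
  measurable_fun [set: S] F -> measurable D ->
  P.-integrable [set: T] (F \o J) -> P'.-integrable [set: T'] (F \o J') ->
  (\int[P]_(x in J @^-1` D) F (J x) = \int[P']_(x in J' @^-1` D) F (J' x))%E.
Proof.
move=> mF mD i i'.
rewrite -[LHS](integral_pushforward (phi := J) _ mF)//; last first.
  by apply: integrableS i => //; exact: measurable_funPTI.
rewrite -[RHS](integral_pushforward (phi := J') _ mF)//; last first.
  by apply: integrableS i' => //; exact: measurable_funPTI.
apply: eq_measure_integral => A mA _; exact: lawJ.
Qed.

(** In integral form the identity only involves functions of [J] integrated over preimages under
    [J], and these integrals are determined by the law of [J]. *)
Lemma eq_law_condexp (dV : measure_display) (TV : measurableType dV)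
    (v : S -> TV) (V : {mfun T >-> TV}) (V' : {mfun T' >-> TV})
    (y1 y2 : S -> R) :
  measurable_fun [set: S] v -> V =1 v \o J -> V' =1 v \o J' ->
  measurable_fun [set: S] y1 -> measurable_fun [set: S] y2 ->
  P.-integrable [set: T] (EFin \o (y1 \o J)) ->
  P.-integrable [set: T] (EFin \o (y2 \o J)) ->
  P'.-integrable [set: T'] (EFin \o (y1 \o J')) ->
  P'.-integrable [set: T'] (EFin \o (y2 \o J')) ->
  as_eq P' 'CE_P'[y1 \o J' | V'] 'CE_P'[y2 \o J' | V'] ->
  as_eq P 'CE_P[y1 \o J | V] 'CE_P[y2 \o J | V].
Proof.
move=> mv VE VE' /measurable_EFinP m1 /measurable_EFinP m2 i1 i2 i1' i2'.
move=> /(as_eq_condexpP V' i1' i2') e12; apply/(as_eq_condexpP V i1 i2) => B mB.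
have mvB : measurable (v @^-1` B) by rewrite -[_ @^-1` _]setTI; exact: mv.
have := e12 _ mB.
have -> : V @^-1` B = J @^-1` (v @^-1` B).
  by apply/seteqP; split=> x /=; rewrite VE.
have -> : V' @^-1` B = J' @^-1` (v @^-1` B).
  by apply/seteqP; split=> x /=; rewrite VE'.
by rewrite -(eq_law_integral m1)// -(eq_law_integral m2).
Qed.

End equal_laws.

(** * Consequences of the model assumptions, and the theorem *)

Lemma bridge_condexp (R : realType) (d dU : measure_display)
    (T : measurableType d) (TU : measurableType dU) (P : probability T R)
    (U : {RV P >-> TU}) (Y Z W : {RV P >-> R}) (h0 g0 : R -> R) :
  P.-integrable [set: T] (EFin \o Y) -> confounding_bridge U Y Z W h0 g0 ->
  [/\ as_eq P 'CE_P[Y | Z] 'CE_P[h0 \o W | Z],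
      as_eq P 'CE_P[Y | W] 'CE_P[g0 \o Z | W],
      as_eq P 'CE_P[Y | U] 'CE_P[h0 \o W | U]
    & as_eq P 'CE_P[Y | U] 'CE_P[g0 \o Z | U]].
Proof.
move=> iY [sqh eh sqg eg].
have ih := square_integrable_at_integrable sqh.
have ig := square_integrable_at_integrable sqg.
have mUV (V : {RV P >-> R}) : measurable_fun [set: T] (fun x => (U x, V x)).
  by apply: measurable_fun_pair; exact: measurable_funPT.
by split; [apply: (condexp_tower (q := snd) (mUV Z)) |
  apply: (condexp_tower (q := snd) (mUV W)) |
  apply: (condexp_tower (q := fst) (mUV Z)) |
  apply: (condexp_tower (q := fst) (mUV W))].
Qed.

Lemma cond_mutually_independent_pair (R : realType) (d dU : measure_display)
    (T : measurableType d) (TU : measurableType dU) (P : probability T R)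
    (U : {RV P >-> TU}) (X Y Z W : {RV P >-> R}) :
  cond_mutually_independent U X Y Z W ->
  [/\ cond_indep_pair P U X Y, cond_indep_pair P U X Z
    & cond_indep_pair P U X W].
Proof.
move=> indep.
(* The factors belonging to whole lines are conditional probabilities of the whole space, hence
   almost surely 1. *)
have CE1 : as_eq P 'CE_P[\1_[set: T] | U] (fun=> 1).
  rewrite indicT.
  apply: (is_condexp_unique _ (is_condexp_cst P U 1)) => //.
  by apply: is_condexp_condexp; exact: finite_measure_integrable_cst.
by split=> A B mA mB;
  [have := indep A B setT setT mA mB measurableT measurableT |
   have := indep A setT B setT mA measurableT mB measurableT |
   have := indep A setT setT B mA measurableT measurableT mB];
  rewrite !preimage_setT !setIT; apply: filterS2 CE1 => x -> ->;
  rewrite !mulr1.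
Qed.

(** Carries solutions of the observed equations from one model to another with the same observed
    law, so that both candidates live on one probability space, where uniqueness compares them. *)
Lemma same_joint_law_bridge (R : realType) (d d' : measure_display)
    (T : measurableType d) (T' : measurableType d') (P : probability T R)
    (P' : probability T' R) (X Y Z W : {RV P >-> R})
    (X' Y' Z' W' : {RV P' >-> R}) (h g : R -> R) :
  P.-integrable [set: T] (EFin \o Y) -> P'.-integrable [set: T'] (EFin \o Y') ->
  same_joint_law X Y Z W X' Y' Z' W' ->
  square_integrable_at W' h -> square_integrable_at Z' g ->
  as_eq P' 'CE_P'[Y' | Z'] 'CE_P'[h \o W' | Z'] ->
  as_eq P' 'CE_P'[Y' | W'] 'CE_P'[g \o Z' | W'] ->
  [/\ square_integrable_at W h, square_integrable_at Z g,
      as_eq P 'CE_P[Y | Z] 'CE_P[h \o W | Z]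
    & as_eq P 'CE_P[Y | W] 'CE_P[g \o Z | W]].
Proof.
move=> iY iY' law sqh' sqg' eh eg.
pose J x := (X x, Y x, Z x, W x); pose J' x := (X' x, Y' x, Z' x, W' x).
have mJ : measurable_fun [set: T] J.
  by do 3 (apply: measurable_fun_pair => //).
have mJ' : measurable_fun [set: T'] J'.
  by do 3 (apply: measurable_fun_pair => //).
pose K : {mfun T >-> (R * R * R * R)%type} :=
  HB.pack J (isMeasurableFun.Build _ _ _ _ J mJ).
pose K' : {mfun T' >-> (R * R * R * R)%type} :=
  HB.pack J' (isMeasurableFun.Build _ _ _ _ J' mJ').
have lawK A : measurable A -> P (K @^-1` A) = P' (K' @^-1` A) := law A.
pose y (p : R * R * R * R) := p.1.1.2.
pose z (p : R * R * R * R) := p.1.2.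
pose w (p : R * R * R * R) := p.2.
have my : measurable_fun setT y.
  by apply: (measurableT_comp measurable_snd); exact: (measurableT_comp measurable_fst).
have mz : measurable_fun setT z.
  exact: (measurableT_comp measurable_snd).
have mw : measurable_fun setT w by exact: measurable_snd.
(* The second moment of f(V) is the integral of a nonnegative function of the observed quadruple, so
   it depends only on the joint law. *)
have sq (f : R -> R) (v : R * R * R * R -> R) (V : {RV P >-> R})
    (V' : {RV P' >-> R}) : measurable_fun setT v -> V =1 v \o K ->
    V' =1 v \o K' -> square_integrable_at V' f -> square_integrable_at V f.
  move=> mv VE VE' [mf]; rewrite unlock => f2; split => //; rewrite unlock.
  have mF : measurable_fun setT (fun p => (f (v p) ^+ 2)%:E).
    by apply/measurable_EFinP; apply: measurable_funX; exact: (measurableT_comp mf).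
  under eq_integral do rewrite VE.
  rewrite (eq_law_ge0_integral lawK mF)//.
    by move: f2; under eq_integral do rewrite VE'.
  by move=> s; rewrite lee_fin sqr_ge0.
have sqh := sq h w W W' mw (fun=> erefl) (fun=> erefl) sqh'.
have sqg := sq g z Z Z' mz (fun=> erefl) (fun=> erefl) sqg'.
have mhw : measurable_fun setT (h \o w).
  by case: sqh => mh _; exact: (measurableT_comp mh).
have mgz : measurable_fun setT (g \o z).
  by case: sqg => mg _; exact: (measurableT_comp mg).
have ih := square_integrable_at_integrable sqh.
have ig := square_integrable_at_integrable sqg.
have ih' := square_integrable_at_integrable sqh'.
have ig' := square_integrable_at_integrable sqg'.
split => //.
- exact: (eq_law_condexp lawK mz (fun=> erefl) (fun=> erefl) my mhw iY ih iY' ih' eh).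
- exact: (eq_law_condexp lawK mw (fun=> erefl) (fun=> erefl) my mgz iY ig iY' ig' eg).
Qed.

Theorem theorem1 (R : realType)
    (d : measure_display) (T : measurableType d) (P : probability T R)
    (dU : measure_display) (TU : measurableType dU)
    (X Y Z W : {RV P >-> R}) (U : {RV P >-> TU}) (h0 g0 : R -> R)
    (intY : P.-integrable [set: T] (EFin \o Y))
    (A1 : confounding_bridge U Y Z W h0 g0)
    (A2 : completeness Z W) :
  (* existence, uniqueness, and equality with the bridge functions *)
  (exists h : R -> R,
    [/\ square_integrable_at W h,
        as_eq P 'CE_P[Y | Z] 'CE_P[h \o W | Z],
        forall h' : R -> R, square_integrable_at W h' ->
          as_eq P 'CE_P[Y | Z] 'CE_P[h' \o W | Z] ->
          as_eq P (h' \o W) (h \o W)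
      & as_eq P (h \o W) (h0 \o W)]) /\
  (exists g : R -> R,
    [/\ square_integrable_at Z g,
        as_eq P 'CE_P[Y | W] 'CE_P[g \o Z | W],
        forall g' : R -> R, square_integrable_at Z g' ->
          as_eq P 'CE_P[Y | W] 'CE_P[g' \o Z | W] ->
          as_eq P (g' \o Z) (g \o Z)
      & as_eq P (g \o Z) (g0 \o Z)]) /\
  (* identifiability from the joint law of the observed variables *)
  (forall (d' : measure_display) (T' : measurableType d')
      (P' : probability T' R)
      (dU' : measure_display) (TU' : measurableType dU')
      (X' Y' Z' W' : {RV P' >-> R}) (U' : {RV P' >-> TU'})
      (h0' g0' : R -> R),
    P'.-integrable [set: T'] (EFin \o Y') ->
    confounding_bridge U' Y' Z' W' h0' g0' ->
    completeness Z' W' ->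
    same_joint_law X Y Z W X' Y' Z' W' ->
    as_eq P (h0' \o W) (h0 \o W) /\ as_eq P (g0' \o Z) (g0 \o Z)) /\
  (* the bridge functions given X, under conditional independence *)
  (cond_mutually_independent U X Y Z W ->
    as_eq P 'CE_P[Y | X] 'CE_P[h0 \o W | X] /\
    as_eq P 'CE_P[h0 \o W | X] 'CE_P[g0 \o Z | X]).
Proof.
have [eZ eW eUh eUg] := bridge_condexp intY A1.
have [sqh _ sqg _] := A1; have [compl_h compl_g] := A2.
have ih := square_integrable_at_integrable sqh.
have ig := square_integrable_at_integrable sqg.
split.
  exists h0; split => //; last exact/aeW.
  by move=> h' sqh' eh'; exact: (complete_condexp_unique compl_h sqh' sqh eh' eZ).
split.
  exists g0; split => //; last exact/aeW.
  by move=> g' sqg' eg'; exact: (complete_condexp_unique compl_g sqg' sqg eg' eW).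
split.
  move=> d' T' P' dU' TU' X' Y' Z' W' U' h0' g0' iY' A1' _ law.
  have [eZ' eW' _ _] := bridge_condexp iY' A1'; have [sqh' _ sqg' _] := A1'.
  have [sqh'' sqg'' eh eg] :=
    same_joint_law_bridge intY iY' law sqh' sqg' eZ' eW'.
  split; first exact: (complete_condexp_unique compl_h sqh'' sqh eh eZ).
  exact: (complete_condexp_unique compl_g sqg'' sqg eg eW).
move=> /cond_mutually_independent_pair[XY XZ XW].
have [[mh _] [mg _]] := (sqh, sqg).
have XYh : as_eq P 'CE_P[Y | X] 'CE_P[h0 \o W | X].
  (* The outcome enters as the identity function of [Y]. *)
  exact: (cond_indep_condexp (f := id) XY XW).
have XYg : as_eq P 'CE_P[Y | X] 'CE_P[g0 \o Z | X].
  exact: (cond_indep_condexp (f := id) XY XZ).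
by split => //; apply: filterS2 XYh XYg => x <- <-.
Qed.
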